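(* Let $(X,d)$ be a compact metric space, $(\Omega,\mathcal{B},\mathbf{P})$ a probability space, and $\xi=\xi(x)$, $x\in X$, a separable real-valued random field which is continuous with respect to $d$ with probability one. Let $\Phi$ be an Orlicz function (not necessarily satisfying the $\Delta_2$ condition) such that $$\Big\|\sup_{x\in X}|\xi(x)|\Big\|_{\Phi}<\infty ,$$ and let $\Psi$ be another Orlicz function which is weaker than $\Phi$, i.e. $\lim_{u\to\infty}\Psi(uv)/\Phi(u)=0$ for every constant $v>0$. Then there exist a random variable $\zeta\ge0$ with $\|\zeta\|_{\Psi}=1$ and a non-random function $h:[0,\operatorname{diam}(d,X)]\to[0,\infty)$, continuous, strictly increasing, with $h(0)=h(0+)=0$ (depending on $\Psi,\Phi$), such that with probability one $$\Delta(\xi,\delta)\le\zeta\cdot h(\delta)\quad\text{for all }\delta\in[0,\operatorname{diam}(d,X)].$$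
   Context: For a function $f:X\to\mathbb{R}$ the modulus of continuity is $\Delta(f,\delta)=\sup_{d(x,y)\le\delta}|f(x)-f(y)|$, $\delta\ge0$, and $\operatorname{diam}(d,X)=\sup_{x,y\in X}d(x,y)$. An Orlicz function is a function $\Phi:\mathbb{R}\to[0,\infty)$ that is convex, even, continuous, twice continuously differentiable on $u\ge2$, strictly increasing on $[0,\infty)$, with $\Phi(0)=0$ and $\lim_{|u|\to\infty}\Phi(u)=\infty$. The Orlicz space $L(\Phi)$ over $(\Omega,\mathcal{B},\mathbf{P})$ carries the Luxemburg norm $\|\zeta\|_{\Phi}=\inf\{k>0:\ \mathbf{E}\,\Phi(\zeta/k)\le1\}$. *)

(* Defs.v *)
From Stdlib Require List.
From HB Require Import structures.
From mathcomp Require Import all_boot all_order all_algebra.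
From mathcomp Require Import all_classical all_reals all_analysis.
Set Implicit Arguments. Unset Strict Implicit. Unset Printing Implicit Defensive.
Import Order.TTheory GRing.Theory Num.Theory.
Import numFieldNormedType.Exports.
Local Open Scope classical_set_scope.
Local Open Scope ring_scope.

Section Defs.
Variable R : realType.

Definition is_metric (X : Type) (dist : X -> X -> R) : Prop :=
  [/\ (forall x y, 0 <= dist x y),
      (forall x y, dist x y = 0 <-> x = y),
      (forall x y, dist x y = dist y x) &
      (forall x y z, dist x z <= dist x y + dist y z)].

Definition d_open (X : Type) (dist : X -> X -> R) (U : set X) : Prop :=
  forall x, U x -> exists2 e : R, 0 < e & forall y, dist x y < e -> U y.

Definition d_compact (X : Type) (dist : X -> X -> R) : Prop :=
  forall (I : Type) (U : I -> set X),
    (forall i, d_open dist (U i)) -> (forall x, exists i, U i x) ->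
    exists s : list I, forall x, exists i, List.In i s /\ U i x.

Definition d_continuous (X : Type) (dist : X -> X -> R) (f : X -> R) : Prop :=
  forall x (e : R), 0 < e -> exists2 del : R, 0 < del &
    forall y, dist x y < del -> `|f x - f y| < e.

Definition diam (X : Type) (dist : X -> X -> R) : R :=
  sup [set dist xy.1 xy.2 | xy in [set: X * X]].

Definition modulus (X : Type) (dist : X -> X -> R) (f : X -> R) (delta : R) : R :=
  sup [set `|f xy.1 - f xy.2| | xy in [set xy : X * X | dist xy.1 xy.2 <= delta]].

Definition orlicz (Phi : R -> R) : Prop :=
  [/\ (forall u, 0 <= Phi u),
      [/\ (forall x y (t : R), 0 <= t <= 1 ->
         Phi (t * x + (1 - t) * y) <= t * Phi x + (1 - t) * Phi y),
      (forall u, Phi (- u) = Phi u) &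
      continuous Phi],
      (forall u, 2 < u -> derivable Phi u 1 /\ derivable (derive1 Phi) u 1
                         /\ {for u, continuous (derive1n 2 Phi)}),
      (forall u v, 0 <= u -> u < v -> Phi u < Phi v) /\ Phi 0 = 0 &
      (Phi x @[x --> +oo] --> +oo) /\ (Phi x @[x --> -oo] --> +oo)].

Definition orlicz_weaker (Psi Phi : R -> R) : Prop :=
  forall v : R, 0 < v -> (Psi (u * v) / Phi u) @[u --> +oo] --> (0 : R).

Local Open Scope ereal_scope.
Definition luxemburg (d : measure_display) (T : measurableType d)
  (P : probability T R) (Phi : R -> R) (zeta : T -> R) : \bar R :=
  ereal_inf [set k%:E | k in [set k : R | (0 < k)%R /\
               \int[P]_w (Phi (zeta w / k))%:E <= 1]].
Local Close Scope ereal_scope.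

(* separability of the random field in the sense of Doob *)
Definition separable_field (X : Type) (dist : X -> X -> R)
  (d : measure_display) (T : measurableType d) (P : probability T R)
  (xi : X -> T -> R) : Prop :=
  exists S : set X, [/\ countable S,
    (forall x (e : R), 0 < e -> exists2 s, S s & dist x s < e) &
    exists N : set T, [/\ measurable N, P N = 0%E &
      forall w, ~ N w -> forall (G : set X) (F : set R),
        d_open dist G -> closed F ->
        (forall x, G x -> S x -> F (xi x w)) -> forall x, G x -> F (xi x w)]].

End Defs.

(* Main.v *)
(* The oscillation G of a path dominates its moduli D_r at scale r. Since Psi is
   weaker than Phi, E Psi(v G) is finite for every v, and D_r -> 0 on continuous
   paths, so by dominated convergence there are r_j > 0 with
   E Psi(2^j D_(r_j)) <= 2^-(j+1). Hence Z = sup_j 2^j D_(r_j) is almost surely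
   finite and E Psi(Z) <= 1. With f = max(1, G, Z), the modulus at delta is at
   most f (2^-j + delta / r_j) for every j: by f 2^-j when delta < r_j, by f
   otherwise. Taking the infimum over j gives a deterministic concave
   majorant vanishing at 0; adding delta makes it strictly increasing, and
   dividing f by its Luxemburg norm normalizes it. *)

Require Import Defs.
From HB Require Import structures.
From mathcomp Require Import all_boot all_order all_algebra.
From mathcomp Require Import all_classical all_reals all_analysis.
From mathcomp Require Import measurable_realfun lra.
Import Order.TTheory GRing.Theory Num.Theory.
Import numFieldNormedType.Exports.
Set Implicit Arguments.
Unset Strict Implicit.
Unset Printing Implicit Defensive.
Local Open Scope classical_set_scope.
Local Open Scope ring_scope.

(** * Uniform continuity and boundedness on a compact metric space *)

Lemma list_lower_bound (R : realType) (I : Type) (g : I -> R) (s : list I) :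
  (forall i, 0 < g i) -> exists2 m, 0 < m & forall i, List.In i s -> m <= g i.
Proof.
move=> g0; elim: s => [|i s [m m0 IH]]; first by exists 1.
exists (Num.min m (g i)); first by rewrite lt_min m0 g0.
by move=> j [<-|/IH mj]; rewrite ge_min ?lexx ?orbT// mj.
Qed.

Lemma list_upper_bound (s : list nat) :
  exists m : nat, forall i, List.In i s -> (i <= m)%N.
Proof.
elim: s => [|i s [m IH]]; first by exists 0%N.
by exists (maxn m i) => j [<-|/IH mj]; rewrite leq_max ?leqnn ?orbT// mj.
Qed.

(** A finite cover by balls of half the continuity radius has a smallest radius [m]. Two points
    closer than [m] then lie in one full ball around a common center, and each value is within
    [e / 2] of the value at that center. *)
Lemma d_continuous_uniform (R : realType) (X : Type) (dist : X -> X -> R) (f : X -> R) :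
  is_metric dist -> d_compact dist -> d_continuous dist f ->
  forall e : R, 0 < e -> exists2 del : R, 0 < del &
    forall x y, dist x y < del -> `|f x - f y| < e.
Proof.
move=> [d0 dE dC dT] cpt cf e e0.
have e20 : 0 < e / 2 by rewrite divr_gt0.
have /choice[r rP] x : exists r : R, 0 < r /\
    forall y, dist x y < r -> `|f x - f y| < e / 2.
  by have [r r0 rP] := cf x _ e20; exists r.
have r0 x : 0 < r x / 2 by rewrite divr_gt0// (rP x).1.
have [||s sP] := cpt X (fun x => [set y | dist x y < r x / 2]).
- move=> x y /= xy; exists (r x / 2 - dist x y); first by rewrite subr_gt0.
  by move=> z; rewrite ltrBrDl; apply: le_lt_trans.
- by move=> x; exists x => /=; rewrite (dE x x).2.
have [m m0 mP] := @list_lower_bound R X (fun x => r x / 2) s r0.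
exists m => // x y xy; have [z [zs /= zx]] := sP x.
have rz := (rP z).1; have zy : dist z y < r z.
  apply: le_lt_trans (dT _ x _) _.
  by have := mP _ zs; lra.
have := (rP z).2 _ zy; have /(rP z).2 : dist z x < r z by lra.
rewrite distrC => h1 h2; have -> : f x - f y = (f x - f z) + (f z - f y) by lra.
by apply: le_lt_trans (ler_normD _ _) _; lra.
Qed.

(** The sets where [|f| < n] form an increasing open cover, so a finite subcover reduces to its
    largest index. *)
Lemma d_continuous_bounded (R : realType) (X : Type) (dist : X -> X -> R) (f : X -> R) :
  d_compact dist -> d_continuous dist f -> exists M, forall x, `|f x| <= M.
Proof.
move=> cpt cf.
have [||s sP] := cpt nat (fun n => [set y | `|f y| < n%:R]).
- move=> n x /=; rewrite -subr_gt0 => /(cf x)[del del0 h].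
  exists del => // y /h; rewrite distrC => fyx.
  have := ler_normD (f y - f x) (f x); rewrite subrK; lra.
- by move=> x; exists (Num.Def.archi_bound `|f x|); apply: archi_boundP.
have [m mP] := list_upper_bound s; exists m%:R => x.
by have [i [/mP im /= /ltW/le_trans]] := sP x; apply; rewrite ler_nat.
Qed.

(** * The deterministic modulus as an infimum of affine functions *)

(* An infimum of affine functions is concave and vanishes at 0, which makes
   it subadditive, hence continuous. *)
Definition affine_inf (R : realType) (r : nat -> R) (t : R) : R :=
  inf (range (fun j => (1 / 2) ^+ j + t / r j)).

Section affine_inf.
Variables (R : realType) (r : nat -> R).
Hypothesis r0 : forall j, 0 < r j.
Implicit Types s t : R.

Let term_gt0 j t : 0 <= t -> 0 < (1 / 2) ^+ j + t / r j.
Proof.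
move=> t0; apply: ltr_pwDl; first by rewrite exprn_gt0.
by rewrite divr_ge0// ltW.
Qed.

Lemma affine_inf_le t j : 0 <= t -> affine_inf r t <= (1 / 2) ^+ j + t / r j.
Proof.
move=> t0; apply: ge_inf; last by exists j.
by exists 0 => _ [i _ <-]; rewrite ltW// term_gt0.
Qed.

Lemma le_affine_inf t c :
  (forall j, c <= (1 / 2) ^+ j + t / r j) -> c <= affine_inf r t.
Proof.
move=> h; apply: lb_le_inf; last by move=> _ [i _ <-].
by exists ((1 / 2) ^+ 0 + t / r 0%N), 0%N.
Qed.

Lemma affine_inf_ge0 t : 0 <= t -> 0 <= affine_inf r t.
Proof. by move=> t0; apply: le_affine_inf => j; rewrite ltW// term_gt0. Qed.

Lemma affine_inf_mono s t : 0 <= s -> s <= t -> affine_inf r s <= affine_inf r t.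
Proof.
move=> s0 st; apply: le_affine_inf => j; apply: le_trans (affine_inf_le j s0) _.
by rewrite lerD2l ler_pM2r// invr_gt0.
Qed.

(** Given one term for [s] and another for [t], evaluate at [s + t] the one of smaller slope, that
    is, of larger [r]. Its slope is at most that of the other, and the spare constant is
    positive. *)
Lemma affine_infD s t : 0 <= s -> 0 <= t ->
  affine_inf r (s + t) <= affine_inf r s + affine_inf r t.
Proof.
move=> s0 t0; rewrite -lerBlDr; apply: le_affine_inf => i.
rewrite lerBlDr -lerBlDl; apply: le_affine_inf => j; rewrite lerBlDl.
have p k : 0 < (1 / 2 : R) ^+ k by rewrite exprn_gt0.
have [rij|/ltW rji] := leP (r i) (r j).
- apply: le_trans (affine_inf_le j (addr_ge0 s0 t0)) _; rewrite mulrDl.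
  have : s / r j <= s / r i by rewrite ler_wpM2l// lef_pV2// posrE.
  by have := p i; lra.
- apply: le_trans (affine_inf_le i (addr_ge0 s0 t0)) _; rewrite mulrDl.
  have : t / r i <= t / r j by rewrite ler_wpM2l// lef_pV2// posrE.
  by have := p j; lra.
Qed.

Lemma affine_inf_small (e : R) : 0 < e ->
  exists2 del : R, 0 < del & forall t, 0 <= t -> t < del -> affine_inf r t < e.
Proof.
move=> e0.
have : (1 / 2 : R) ^+ j @[j --> \oo] --> (0 : R).
  by apply: cvg_expr; rewrite ger0_norm//; lra.
move=> /cvgrPdist_lt /(_ (e / 2)) -[|n _ /(_ n (leqnn n))]; first by lra.
rewrite /= sub0r normrN ger0_norm ?exprn_ge0// => ne.
exists (e / 2 * r n); first by rewrite mulr_gt0//; lra.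
move=> t t0 te; apply: le_lt_trans (affine_inf_le n t0) _.
have : t / r n < e / 2 by rewrite ltr_pdivrMr.
lra.
Qed.

Lemma affine_inf0 : affine_inf r 0 = 0.
Proof.
apply/eqP; rewrite eq_le affine_inf_ge0// andbT leNgt; apply/negP => h.
by have [del del0 /(_ 0 (lexx 0) del0)] := affine_inf_small h; rewrite ltxx.
Qed.

(** Subadditivity and monotonicity bound the difference of the values at [t] and [u] by the value at
    [|t - u|], which is small near 0. The absolute value extends the function evenly to the line;
    the infimum is controlled only at nonnegative arguments. *)
Lemma affine_inf_continuous : continuous (fun t => affine_inf r `|t|).
Proof.
move=> t; apply/cvgrPdist_lt => e /affine_inf_small[del del0 h].
have : \forall u \near t, `|t - u| < del by apply/nbhs_ballP; exists del.
apply: filterS => u /(h _ (normr_ge0 _)); apply: le_lt_trans.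
suff key (a b : R) : affine_inf r `|a| <= affine_inf r `|b| + affine_inf r `|a - b|.
  have := key t u; have := key u t; rewrite (distrC u t) => h1 h2.
  by rewrite ler_norml; apply/andP; split; lra.
apply: le_trans (affine_infD (normr_ge0 b) (normr_ge0 (a - b))).
apply: affine_inf_mono => //.
by rewrite -{1}(subrK b a) addrC ler_normD.
Qed.

End affine_inf.

(** * Elementary properties of Orlicz functions *)

Section orlicz_facts.
Variables (R : realType) (Psi : R -> R).
Hypothesis oPsi : orlicz Psi.
Implicit Types u v : R.

Lemma orlicz_ge0 u : 0 <= Psi u.
Proof. by case: oPsi. Qed.

Lemma orlicz0 : Psi 0 = 0.
Proof. by case: oPsi => _ _ _ []. Qed.

Lemma orlicz_continuous : continuous Psi.
Proof. by case: oPsi => _ []. Qed.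

Lemma orlicz_mono u v : 0 <= u -> u <= v -> Psi u <= Psi v.
Proof.
case: oPsi => _ _ _ [h _] _ u0; rewrite le_eqVlt => /orP[/eqP->//|uv].
by rewrite ltW// h.
Qed.

Lemma orlicz_gt0 u : 0 < u -> 0 < Psi u.
Proof. by case: oPsi => _ _ _ [h P0] _ u0; rewrite -P0 h. Qed.

Lemma orlicz_unbounded (M : R) : exists2 u, 0 < u & M < Psi u.
Proof.
case: oPsi => _ _ _ _ [/cvgryPgt /(_ M) h _].
have [A [_ hA]] := h; exists (Num.max 1 (A + 1)); first by rewrite lt_max ltr01.
by apply: hA; rewrite lt_max ltrDl ltr01 orbT.
Qed.

Lemma orlicz_lt_inv u v : 0 <= v -> Psi u < Psi v -> u < v.
Proof.
move=> v0; rewrite !ltNge; apply: contra => vu.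
exact: orlicz_mono.
Qed.

Lemma orlicz_div u k : 1 <= k -> Psi (u / k) <= Psi u / k.
Proof.
case: oPsi => _ [cvx _ _] _ [_ P0] _ k1.
have k0 : 0 < k by lra.
have /(cvx u 0) : 0 <= k^-1 <= 1 by rewrite invr_ge0 ltW//= invf_le1.
by rewrite P0 !mulr0 !addr0 mulrC (mulrC k^-1).
Qed.

Lemma measurable_orlicz d (T : measurableType d) (f : T -> R) :
  measurable_fun setT f -> measurable_fun setT (fun w => (Psi (f w))%:E).
Proof.
move=> mf; apply/measurable_EFinP.
apply: (measurableT_comp _ mf).
exact: continuous_measurable_fun orlicz_continuous.
Qed.

End orlicz_facts.

(** * Monotone integrals and suprema of sequences *)

(* [ge0_le_integral] requires both sides to be measurable. *)
Lemma ge0_le_integral_nonmeasurable d (T : measurableType d) (R : realType)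
    (mu : {measure set T -> \bar R}) (f g : T -> \bar R) :
  (forall w, (0 <= f w)%E) -> (forall w, (f w <= g w)%E) ->
  (\int[mu]_w f w <= \int[mu]_w g w)%E.
Proof.
move=> f0 fg; have g0 w : (0 <= g w)%E by exact: le_trans (fg w).
rewrite !ge0_integralTE//; apply: le_ereal_sup => _ [h hf <-].
by exists h => // w; exact: le_trans (hf w) (fg w).
Qed.

Section sups0.
Variables (R : realType) (u : nat -> R).

(** The supremum of a sequence is kept in the form [sups u 0], to which [measurable_fun_sups]
    applies. *)
Let sups0E : sups u 0 = sup (range u).
Proof. by rewrite /sups /= /sdrop; congr (sup (image _ _)); apply/seteqP; split. Qed.

Lemma ge_sups0 (c : R) : (forall j, u j <= c) -> sups u 0 <= c.
Proof.
move=> uc; rewrite sups0E; apply: ge_sup; first by exists (u 0%N), 0%N.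
by move=> _ [j _ <-].
Qed.

Lemma le_sups0 j : has_ubound (range u) -> u j <= sups u 0.
Proof. by move=> ub; rewrite sups0E; apply: ub_le_sup => //; exists j. Qed.

Lemma sups0_adherent (e : R) : 0 < e -> has_ubound (range u) ->
  exists j, sups u 0 < u j + e.
Proof.
move=> e0 ub; have [|_ [j _ <-] uj] := @sup_adherent R (range u) e e0.
  by split; [exists (u 0%N), 0%N|].
by exists j; rewrite sups0E -ltrBlDr.
Qed.

End sups0.

(** * Luxemburg normalization and domination of a sequence *)

Section luxemburg.
Variables (R : realType) (d : measure_display) (T : measurableType d).
Variables (P : probability T R) (Psi : R -> R).
Hypothesis oPsi : orlicz Psi.

(** [K] is the Luxemburg norm of [f]: it is positive because [f] is at least 1, and finite because
    [Psi (f w)] is integrable. Homogeneity of the norm does the rest. *)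
Lemma luxemburg_normalize (f : T -> R) :
  measurable_fun setT f -> (forall w, 1 <= f w) ->
  (\int[P]_w (Psi (f w))%:E < +oo)%E ->
  exists2 K : R, 0 < K & luxemburg P Psi (fun w => f w / K) = 1%E.
Proof.
move=> mf f1 If.
pose A := [set k : R | 0 < k /\ (\int[P]_w (Psi (f w / k))%:E <= 1)%E].
have [c c0 Pc] := orlicz_unbounded oPsi 1.
(* If [k < 1 / c], then [Psi (1 / k)] is at least [Psi c > 1], whereas [f >= 1] bounds it by the
   integral of [Psi (f / k)], which is at most 1. *)
have Alb : lbound A c^-1.
  move=> k [k0 Ik]; rewrite -[leRHS]invrK lef_pV2 ?posrE ?invr_gt0//.
  rewrite leNgt; apply/negP => ck.
  have : (Psi k^-1 <= 1).
    rewrite -lee_fin; apply: le_trans Ik.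
    have <- : (\int[P]_w (cst (Psi k^-1)%:E w) = (Psi k^-1)%:E)%E.
      by rewrite integral_cst// [X in (_ * X)%E](probability_setT P) mule1.
    apply: ge0_le_integral_nonmeasurable => w /=; rewrite lee_fin; first exact: orlicz_ge0.
    have k'0 : 0 <= k^-1 by rewrite invr_ge0 ltW.
    by apply: orlicz_mono => //; rewrite ler_peMl.
  by have := orlicz_mono oPsi (ltW c0) (ltW ck); lra.
have A0 : A !=set0.
  have I0 : (0 <= \int[P]_w (Psi (f w))%:E)%E.
    by apply: integral_ge0 => w _; rewrite lee_fin orlicz_ge0.
  have /fineK If' : (\int[P]_w (Psi (f w))%:E)%E \is a fin_num.
    by rewrite ge0_fin_numE.
  set M := fine _ in If'.
  have M0 : 0 <= M by rewrite -lee_fin If'.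
  have k0 : 0 < M + 1 by lra.
  (* By convexity the integral at scale [M + 1] is at most [M / (M + 1)]. *)
  exists (M + 1); split => //.
  apply: (@le_trans _ _ (\int[P]_w ((M + 1)^-1%:E * (Psi (f w))%:E))%E).
    apply: ge0_le_integral_nonmeasurable => w; rewrite -?EFinM lee_fin.
      exact: orlicz_ge0.
    by rewrite [leRHS]mulrC; apply: orlicz_div => //; rewrite lerDr.
  rewrite ge0_integralZl//; [|exact: measurable_orlicz| |].
  - by rewrite -If' -EFinM lee_fin mulrC ler_pdivrMr// mul1r lerDl.
  - by move=> w _; rewrite lee_fin orlicz_ge0.
  - by rewrite lee_fin invr_ge0 ltW.
have c'0 : 0 < c^-1 by rewrite invr_gt0.
have K0 : 0 < inf A by apply: lt_le_trans c'0 (lb_le_inf A0 Alb).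
exists (inf A) => //; rewrite /luxemburg.
(* The scales admissible for [f / K] are those admissible for [f], divided by [K]. *)
transitivity (ereal_inf [set ((inf A)^-1%:E * x)%E | x in [set k%:E | k in A]]).
  congr ereal_inf; apply/seteqP; split => [_ [k [k0 Ik] <-]|_ [_ [k [k0 Ik] <-] <-]].
    exists (k * inf A)%:E; last by rewrite -EFinM mulrCA mulVf ?mulr1// gt_eqF.
    exists (k * inf A) => //; split; first by rewrite mulr_gt0.
    suff E w : f w / (k * inf A) = f w / inf A / k by under eq_integral do rewrite E.
    by rewrite invfM mulrA mulrAC.
  exists ((inf A)^-1 * k); rewrite ?EFinM//; split; first by rewrite mulr_gt0 ?invr_gt0.
  suff E w : f w / inf A / ((inf A)^-1 * k) = f w / k by under eq_integral do rewrite E.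
  by rewrite invfM invrK -mulrA mulKf// gt_eqF.
rewrite ereal_inf_pZl ?invr_gt0// ereal_inf_EFin//; last by exists c^-1.
by rewrite -EFinM mulVf// gt_eqF.
Qed.

(** The bounds sum to 1, so the series [S] of the [Psi (f j w)] is integrable and almost surely
    finite. Where it is finite, unboundedness of [Psi] bounds the sequence [f j w], and [Psi] of its
    supremum is at most [S]. *)
Lemma ae_dominating (f : nat -> T -> R) :
  (forall j, measurable_fun setT (f j)) -> (forall j w, 0 <= f j w) ->
  (forall j, (\int[P]_w (Psi (f j w))%:E <= (1 / (2 ^ (j + 1))%:R)%:E)%E) ->
  exists2 Z : T -> R, measurable_fun setT Z &
    [/\ (forall w, 0 <= Z w), {ae P, forall w, forall j, f j w <= Z w} &
        (\int[P]_w (Psi (Z w))%:E < +oo)%E].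
Proof.
move=> mf f0 If.
pose S w := (\sum_(0 <= j <oo) (Psi (f j w))%:E)%E.
have mPf j : measurable_fun setT (fun w => (Psi (f j w))%:E).
  exact: measurable_orlicz.
have Pf0 j w : (0 <= (Psi (f j w))%:E)%E by rewrite lee_fin orlicz_ge0.
have S0 w : (0 <= S w)%E by exact: nneseries_ge0.
have mS : measurable_fun setT S by exact: ge0_emeasurable_sum.
have IS : (\int[P]_w S w < +oo)%E.
  rewrite integral_nneseries//.
  apply: (@le_lt_trans _ _ (\sum_(0 <= j <oo) (1 / (2 ^ (j + 1))%:R)%:E)%E).
    by apply: lee_nneseries => // j _ _; exact: integral_ge0.
  by have /cvg_lim -> // := @cvg_geometric_eseries_half R 1 0; rewrite ltry.
have fS j w : ((Psi (f j w))%:E <= S w)%E.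
  apply: (@le_trans _ _ (\sum_(0 <= i < j.+1) (Psi (f i w))%:E)%E).
    by rewrite big_nat_recr//= leeDr// sume_ge0.
  exact: nneseries_lim_ge.
have Sfin : {ae P, forall w, S w \is a fin_num}.
  have : P.-integrable setT S.
    apply/integrableP; split => //.
    by under eq_integral do rewrite gee0_abs//.
  by move/integrable_ae => /(_ measurableT); apply: filterS => w; exact.
have [B [mB PB SB]] := Sfin.
(* Zeroing the sequence on the null set [B] makes it bounded at every [w], so that its supremum is
   never a default value. *)
pose g j w := f j w * \1_(~` B) w.
have mg j : measurable_fun setT (g j).
  by apply: measurable_funM => //; apply: measurable_indic; exact: measurableC.
have gB j w : B w -> g j w = 0.
  by move=> Bw; rewrite /g indicE memNset ?mulr0//; exact.
have gNB j w : ~ B w -> g j w = f j w.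
  by move=> Bw; rewrite /g indicE mem_set ?mulr1.
have SNB w : ~ B w -> S w \is a fin_num.
  by move=> Bw; apply: contrapT => /SB.
have g0 j w : 0 <= g j w.
  by have [/gB->|/gNB->] := pselect (B w).
have gub w : has_ubound (range (g ^~ w)).
  have [Bw|Bw] := pselect (B w).
    by exists 0 => _ [j _ <-]; rewrite gB.
  have [u u0 Pu] := orlicz_unbounded oPsi (fine (S w)).
  exists u => _ [j _ <-]; rewrite gNB//.
  apply/ltW/(orlicz_lt_inv oPsi (ltW u0)); apply: le_lt_trans Pu.
  by rewrite -lee_fin fineK ?SNB.
exists (fun w => sups (g ^~ w) 0); first exact: measurable_fun_sups.
have Zge w j : g j w <= sups (g ^~ w) 0.
  exact: (@le_sups0 _ (g ^~ w)).
have Z0 w : 0 <= sups (g ^~ w) 0 by exact: le_trans (g0 0%N w) (Zge w 0%N).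
split => //.
  exists B; split => // w; apply: contra_notP => Bw /= j.
  by rewrite -(gNB j w).
apply: le_lt_trans IS; apply: ge0_le_integral_nonmeasurable => w.
  by rewrite lee_fin orlicz_ge0.
have [Bw|Bw] := pselect (B w).
  rewrite (_ : sups _ _ = 0) ?orlicz0//.
  by apply/eqP; rewrite eq_le Z0 andbT; apply: ge_sups0 => j; rewrite gB.
(* Were [Psi] at the supremum above [S], continuity would put it above [S] at some [g j w] close to
   the supremum, contradicting [fS]. *)
rewrite -[leRHS]fineK ?SNB// lee_fin leNgt; apply/negP => SZ.
have : \forall u \near sups (g ^~ w) 0, fine (S w) < Psi u.
  by have /cvgr_gt/(_ _ SZ) := orlicz_continuous oPsi (x := sups (g ^~ w) 0).
move=> /nbhs_ballP[e /= e0 he].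
have [j Zj] := sups0_adherent e0 (gub w).
have : fine (S w) < Psi (g j w).
  by apply: he; rewrite /ball /= ger0_norm ?subr_ge0 ?Zge// ltrBlDl.
by rewrite ltNge -lee_fin fineK ?SNB// gNB// fS.
Qed.

End luxemburg.

(** * Measurable envelopes for the oscillation of paths *)

Lemma dense_pairs (R : realType) (X : Type) (dist : X -> X -> R) (S : set X) (x0 : X) :
  countable S -> (forall x (e : R), 0 < e -> exists2 s, S s & dist x s < e) ->
  exists p : nat -> X * X, forall x y (e : R), 0 < e ->
    exists m, dist x (p m).1 < e /\ dist y (p m).2 < e.
Proof.
move=> /countable_injP[f finj] dS.
(* [q] inverts the injection [f] on [S] and takes the value [x0] at numbers that code no point of
   [S]. *)
have /choice[q qP] n : exists x, forall s, S s -> f s = n -> s = x.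
  have [[s [Ss fs]]|h] := pselect (exists s, S s /\ f s = n).
    by exists s => s' Ss' fs'; apply: finj; rewrite ?inE// fs fs'.
  by exists x0 => s Ss fs; case: h; exists s.
exists (fun m => if unpickle m is Some (i, j) then (q i, q j) else (x0, x0)).
move=> x y e e0; have [s Ss xs] := dS x e e0; have [t St yt] := dS y e e0.
exists (pickle (f s, f t)); rewrite pickleK /=.
by rewrite -(qP _ s Ss erefl) -(qP _ t St erefl).
Qed.

Section oscillation.
Variables (R : realType) (X : Type) (dist : X -> X -> R).
Variables (d : measure_display) (T : measurableType d) (xi : X -> T -> R).
Hypotheses (dm : is_metric dist) (dc : d_compact dist).
Hypothesis mxi : forall x, measurable_fun setT (xi x).
Hypothesis cxi : forall w, d_continuous dist (xi ^~ w).
Variable p : nat -> X * X.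
Hypothesis p_dense : forall x y (e : R), 0 < e ->
  exists m, dist x (p m).1 < e /\ dist y (p m).2 < e.
Implicit Type b : nat -> bool.

(** The weight [b] selects pairs from the dense sequence, and rejected pairs contribute 0. All pairs
    give [G] and the pairs closer than [r] give [D r], so both are handled as one countable,
    measurable supremum. *)
Let term b m w := (b m)%:R * `|xi (p m).1 w - xi (p m).2 w|.

Let osc b w := sups (fun m => term b m w) 0.

Let term_le b m w (c : R) : 0 <= c ->
  (b m -> `|xi (p m).1 w - xi (p m).2 w| <= c) -> term b m w <= c.
Proof. by rewrite /term; case: (b m) => c0 h; rewrite ?mul1r ?mul0r// h. Qed.

Let term_bound M b m w : 0 <= M -> (forall x, `|xi x w| <= M) -> term b m w <= 2 * M.
Proof.
move=> M0 hM; apply: term_le => [|_]; first by rewrite mulr_ge0.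
by apply: le_trans (ler_normB _ _) _; have := hM (p m).1; have := hM (p m).2; lra.
Qed.

Let term_ub b w : has_ubound (range (fun m => term b m w)).
Proof.
have [M hM] := d_continuous_bounded dc (cxi w); exists (2 * M) => _ [m _ <-].
by apply: term_bound => //; exact: le_trans (hM (p 0%N).1).
Qed.

Let le_osc b m w : term b m w <= osc b w.
Proof. exact: (@le_sups0 _ (fun m => term b m w)). Qed.

Let measurable_osc b : measurable_fun setT (osc b).
Proof.
apply: measurable_fun_sups => // m; apply: measurable_funM => //.
by apply: measurableT_comp => //; apply: measurable_funB.
Qed.

Let osc_ge0 b w : 0 <= osc b w.
Proof. by apply: le_trans (le_osc b 0 w); rewrite mulr_ge0. Qed.

(** It suffices that [b] selects all sequence pairs near [(x, y)]: by continuity such a pair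
    reproduces the increment up to an arbitrary [e]. *)
Let osc_dense b x y w (rho : R) : 0 < rho ->
  (forall m, dist x (p m).1 < rho -> dist y (p m).2 < rho -> b m) ->
  `|xi x w - xi y w| <= osc b w.
Proof.
move=> rho0 hb; apply/ler_addgt0Pr => e e0; have e20 : 0 < e / 2 by lra.
have [dx dx0 hx] := cxi w x e20; have [dy dy0 hy] := cxi w y e20.
have [|m [xm ym]] := @p_dense x y (Num.min rho (Num.min dx dy)).
  by rewrite !lt_min rho0 dx0.
move: xm ym; rewrite !lt_min => /and3P[xr /hx xm _] /and3P[yr _ /hy ym].
have := le_osc b m w; rewrite /term hb// mul1r => le_m.
have -> : xi x w - xi y w = (xi x w - xi (p m).1 w) - (xi y w - xi (p m).2 w)
    + (xi (p m).1 w - xi (p m).2 w) by lra.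
apply: le_trans (ler_normD _ _) _; have := ler_normB (xi x w - xi (p m).1 w)
  (xi y w - xi (p m).2 w); lra.
Qed.

Lemma oscillation_envelope_inhabited : exists (G : T -> R) (D : R -> T -> R),
  [/\ measurable_fun setT G, (forall r, measurable_fun setT (D r)),
      (forall r w, 0 <= D r w <= G w) &
  [/\ (forall w (e : R), 0 < e -> exists2 del : R, 0 < del &
        forall r, r <= del -> D r w <= e),
      (forall r x y w, dist x y < r -> `|xi x w - xi y w| <= D r w),
      (forall x y w, `|xi x w - xi y w| <= G w) &
      (forall w M, 0 <= M -> (forall x, `|xi x w| <= M) -> G w <= 2 * M)]].
Proof.
have [d0 dE dC dT] := dm.
exists (osc xpredT), (fun r => osc (fun m => dist (p m).1 (p m).2 < r)).
split=> //.
  move=> r w; rewrite osc_ge0/=; apply: ge_sups0 => m; apply: term_le => // _.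
  by have := le_osc xpredT m w; rewrite /term mul1r.
split.
- move=> w e e0; have [del del0 h] := d_continuous_uniform dm dc (cxi w) e0.
  exists del => // r rdel; apply: ge_sups0 => m; apply: term_le => [|mr]; first exact: ltW.
  by apply/ltW/h; exact: lt_le_trans mr rdel.
(* Moving each endpoint by less than half the gap [r - dist x y] keeps the distance below [r], so
   all nearby pairs are selected. *)
- move=> r x y w xy; apply: (@osc_dense _ _ _ _ ((r - dist x y) / 2)).
    by rewrite divr_gt0 ?subr_gt0.
  move=> m xm ym; apply: le_lt_trans (dT _ x _) _.
  apply: (@le_lt_trans _ _ (dist x (p m).1 + (dist x y + dist y (p m).2))).
    by rewrite dC lerD2l dT.
  lra.
- by move=> x y w; apply: (@osc_dense _ _ _ _ 1).
- by move=> w M M0 hM; apply: ge_sups0 => m; apply: term_bound.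
Qed.

End oscillation.

Lemma oscillation_envelope (R : realType) (X : Type) (dist : X -> X -> R)
    (d : measure_display) (T : measurableType d) (xi : X -> T -> R) (S : set X) :
  is_metric dist -> d_compact dist ->
  (forall x, measurable_fun setT (xi x)) ->
  (forall w, d_continuous dist (xi ^~ w)) ->
  countable S -> (forall x (e : R), 0 < e -> exists2 s, S s & dist x s < e) ->
  exists (G : T -> R) (D : R -> T -> R),
  [/\ measurable_fun setT G, (forall r, measurable_fun setT (D r)),
      (forall r w, 0 <= D r w <= G w) &
  [/\ (forall w (e : R), 0 < e -> exists2 del : R, 0 < del &
        forall r, r <= del -> D r w <= e),
      (forall r x y w, dist x y < r -> `|xi x w - xi y w| <= D r w),
      (forall x y w, `|xi x w - xi y w| <= G w) &
      (forall w M, 0 <= M -> (forall x, `|xi x w| <= M) -> G w <= 2 * M)]].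
Proof.
move=> dm dc mxi cxi cS dS.
have [[x0]|nX] := pselect (inhabited X).
  have [p hp] := dense_pairs x0 cS dS.
  exact: (oscillation_envelope_inhabited dm dc mxi cxi hp).
(* Over an empty space there are no pairs to enumerate, and zero envelopes serve. *)
exists (cst 0), (fun=> cst 0); split => //; first by move=> r w; rewrite lexx.
split => /=.
- by move=> w e e0; exists 1 => // r _; exact: ltW.
- by move=> r x; case: nX.
- by move=> x; case: nX.
- by move=> w M M0 _; rewrite mulr_ge0.
Qed.

(** * Integrability under the weaker Orlicz function *)

(** Beyond some [B] the ratio is below 1; up to [B], monotonicity bounds the left side by
    [C = Psi (B * v)]. Taking [B > 0] makes [Phi u] positive beyond it, so the ratio bound can be
    cleared. *)
Lemma orlicz_weaker_le (R : realType) (Phi Psi : R -> R) (v : R) :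
  orlicz Phi -> orlicz Psi -> orlicz_weaker Psi Phi -> 0 < v ->
  exists2 C, 0 <= C & forall u, 0 <= u -> Psi (u * v) <= Phi u + C.
Proof.
move=> oPhi oPsi weak v0.
have [A [_ hA]] := (cvgr_lt _ (weak v v0)) _ (ltr01 : 0 < 1 :> R).
pose B := Num.max 0 A + 1.
have B0 : 0 < B by rewrite ltr_wpDl// le_max lexx.
exists (Psi (B * v)); first exact: orlicz_ge0.
move=> u u0; have [uB|Bu] := leP u B.
  rewrite ler_wpDl ?orlicz_ge0//; apply: orlicz_mono => //.
    by rewrite mulr_ge0// ltW.
  by rewrite ler_wpM2r// ltW.
rewrite ler_wpDr ?orlicz_ge0//.
have /hA : A < u.
  by apply: le_lt_trans Bu; rewrite /B ler_wpDr// le_max lexx orbT.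
by rewrite ltr_pdivrMr ?mul1r; [exact: ltW|apply: orlicz_gt0 => //; exact: lt_trans Bu].
Qed.

(** If [k] is admissible for [S], then [2 * k] is admissible for [G], and comparing [Psi] with [Phi]
    at the factor [2 * k * v] bounds the integral by [1 + C]. The alternative [G w = 0] covers the
    exceptional paths, on which [S] is not controlled. *)
Lemma orlicz_weaker_integrable (R : realType) (d : measure_display)
    (T : measurableType d) (P : probability T R) (Phi Psi : R -> R) (G S : T -> R) :
  orlicz Phi -> orlicz Psi -> orlicz_weaker Psi Phi ->
  measurable_fun setT G -> (forall w, 0 <= G w) ->
  (forall w, G w = 0 \/ G w <= 2 * S w) ->
  (luxemburg P Phi S < +oo)%E ->
  forall v, 0 < v -> (\int[P]_w (Psi (v * G w))%:E < +oo)%E.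
Proof.
move=> oPhi oPsi weak mG G0 GS /ereal_inf_ltP[_ [k [k0 Ik] <-] _] v v0.
have k20 : 0 < 2 * k by rewrite mulr_gt0.
have [C C0 hC] := orlicz_weaker_le oPhi oPsi weak (mulr_gt0 k20 v0).
have IG : (\int[P]_w (Phi (G w / (2 * k)))%:E <= 1)%E.
  apply: le_trans Ik; apply: ge0_le_integral_nonmeasurable => w; rewrite lee_fin.
    exact: orlicz_ge0.
  have [->|GSw] := GS w; first by rewrite mul0r orlicz0// orlicz_ge0.
  apply: orlicz_mono => //; first by rewrite divr_ge0// ltW.
  by rewrite invfM mulrA ler_wpM2r ?invr_ge0 ?(ltW k0)// ler_pdivrMr// mulrC.
apply: (@le_lt_trans _ _ (\int[P]_w ((Phi (G w / (2 * k)))%:E + C%:E))%E).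
  apply: ge0_le_integral_nonmeasurable => w; rewrite lee_fin ?orlicz_ge0//.
  have -> : v * G w = G w / (2 * k) * (2 * k * v).
    by rewrite mulrA divfK ?gt_eqF// mulrC.
  by apply: hC; rewrite divr_ge0// ltW.
rewrite ge0_integralD//.
- have -> : (\int[P]_w C%:E = C%:E)%E.
    by rewrite integral_cst// [X in (_ * X)%E](probability_setT P) mule1.
  by apply: le_lt_trans (leeD2r _ IG) _; rewrite -EFinD ltry.
- by move=> w _; rewrite lee_fin orlicz_ge0.
- by apply: measurable_orlicz => //; apply: measurable_funM.
Qed.

(** Dominated convergence along [r n = 1 / (n + 1)], with dominating function [Psi (v * G w)]. *)
Lemma small_orlicz_integral (R : realType) (d : measure_display)
    (T : measurableType d) (P : probability T R) (Psi : R -> R)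
    (G : T -> R) (D : R -> T -> R) (v c : R) :
  orlicz Psi -> measurable_fun setT G -> (forall r, measurable_fun setT (D r)) ->
  (forall r w, 0 <= D r w <= G w) ->
  (forall w (e : R), 0 < e -> exists2 del : R, 0 < del &
    forall r, r <= del -> D r w <= e) ->
  0 < v -> (\int[P]_w (Psi (v * G w))%:E < +oo)%E -> 0 < c ->
  exists2 r, 0 < r & (\int[P]_w (Psi (v * D r w))%:E <= c%:E)%E.
Proof.
move=> oPsi mG mD D0G Dsmall v0 IG c0.
have D0 r w : 0 <= D r w by have /andP[] := D0G r w.
pose r n : R := n.+1%:R^-1.
have Dcvg w : D (r n) w @[n --> \oo] --> (0 : R).
  apply/cvgrPdist_le => e /(Dsmall w)[del del0 h].
  have : r n @[n --> \oo] --> (0 : R) by exact: cvg_harmonic.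
  move=> /cvgr_le /(_ _ del0); apply: filterS => n /h.
  by rewrite sub0r normrN ger0_norm.
have : (\int[P]_w (Psi (v * D (r n) w))%:E @[n --> \oo] --> \int[P]_w (cst 0 w))%E.
  apply: (@dominated_cvg _ _ _ _ _ measurableT _ _ (fun w => (Psi (v * G w))%:E)) => //.
  - by move=> n; apply: measurable_orlicz => //; apply: measurable_funM.
  - move=> w _; apply: cvg_EFin; first by apply: nearW.
    rewrite /= -(orlicz0 oPsi); apply: continuous_cvg; first exact: orlicz_continuous.
    by rewrite -[X in _ --> X](mulr0 v); apply: cvgM (Dcvg w); exact: cvg_cst.
  - apply/integrableP; split.
      by apply: measurable_orlicz => //; apply: measurable_funM.
    by under eq_integral do rewrite gee0_abs ?lee_fin ?orlicz_ge0//.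
  - move=> n w _; rewrite gee0_abs ?lee_fin ?orlicz_ge0//.
    have /andP[_ DG] := D0G (r n) w.
    by apply: orlicz_mono => //; rewrite ?mulr_ge0 ?ler_wpM2l// ltW.
rewrite integral0 => /fine_cvgP[fin /cvgr_le /(_ c c0) le_c].
have [n [fn /= cn]] := filter_ex (filterI fin le_c).
exists (r n); first by rewrite /r invr_gt0.
by move: cn; rewrite -lee_fin fineK.
Qed.

(** * Construction of the random factor and of the modulus *)

Theorem theorem4p1 (R : realType) (X : Type) (dist : X -> X -> R)
  (d : measure_display) (T : measurableType d) (P : probability T R)
  (xi : X -> T -> R) (Phi Psi : R -> R) :
  is_metric dist -> d_compact dist ->
  (forall x, measurable_fun setT (xi x)) ->
  separable_field dist P xi ->
  {ae P, forall w, d_continuous dist (fun x => xi x w)} ->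
  orlicz Phi ->
  (luxemburg P Phi (fun w => (sup [set `|xi x w| | x in [set: X]])%R) < +oo)%E ->
  orlicz Psi -> orlicz_weaker Psi Phi ->
  exists zeta : T -> R, exists h : R -> R,
    [/\ [/\ measurable_fun setT zeta, (forall w, 0 <= zeta w) &
        luxemburg P Psi zeta = 1%E],
        [/\ (forall t, 0 <= t <= diam dist -> 0 <= h t),
        {within `[0, diam dist], continuous h},
        {in `[0, diam dist] &, forall s t, s < t -> h s < h t} &
        h 0 = 0] &
        {ae P, forall w, forall delta, 0 <= delta <= diam dist ->
           modulus dist (fun x => xi x w) delta <= zeta w * h delta}].
Proof.
move=> dm dc mxi [S [cS dS _]] [N [mN PN cN]] oPhi lux oPsi weak.
have cxi w : ~ N w -> d_continuous dist (xi ^~ w).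
  by move=> Nw; apply: contrapT => /cN.
(* Replacing the field by 0 on the null set [N] makes every path continuous, as the envelope lemma
   requires. *)
pose eta x w := xi x w * \1_(~` N) w.
have etaN x w : N w -> eta x w = 0.
  by move=> Nw; rewrite /eta indicE memNset ?mulr0//; exact.
have etaNN x w : ~ N w -> eta x w = xi x w.
  by move=> Nw; rewrite /eta indicE mem_set ?mulr1.
have meta x : measurable_fun setT (eta x).
  by apply: measurable_funM => //; apply: measurable_indic; exact: measurableC.
have ceta w : d_continuous dist (eta ^~ w).
  have [Nw|Nw] := pselect (N w).
    by move=> x e e0; exists 1 => // y _; rewrite !etaN// subrr normr0.
  move=> x e e0; have [del del0 h] := cxi w Nw x e e0.
  by exists del => // y /h; rewrite !etaNN.
have [G [D [mG mD D0G [Dsmall hD hG GM]]]] :=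
  oscillation_envelope dm dc meta ceta cS dS.
have D0 r w : 0 <= D r w by have /andP[] := D0G r w.
have G0 w : 0 <= G w by have /andP[+ +] := D0G 0 w; exact: le_trans.
have IG v : 0 < v -> (\int[P]_w (Psi (v * G w))%:E < +oo)%E.
  apply: (orlicz_weaker_integrable oPhi oPsi weak mG G0 _ lux) => w.
  have [Nw|Nw] := pselect (N w); [left|right].
    apply/eqP; rewrite eq_le G0 andbT -(mulr0 2); apply: GM => // x.
    by rewrite etaN// normr0.
  (* Boundedness of the path makes the [sup] in the hypothesis a true upper bound. *)
  have [M hM] := d_continuous_bounded dc (cxi w Nw).
  have ub x : `|xi x w| <= sup [set `|xi x w| | x in [set: X]].
    by apply: ub_le_sup; [exists M => _ [y _ <-]|exists x].
  apply: GM => [|x]; last by rewrite etaNN.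
  have [[x]|nX] := pselect (inhabited X); first exact: le_trans (ub x).
  suff -> : [set `|xi x w| | x in [set: X]] = set0 by rewrite sup0.
  by apply/seteqP; split=> [t [x]|//]; case: nX.
have /choice[r rP] j : exists r, 0 < r /\
    (\int[P]_w (Psi (2 ^+ j * D r w))%:E <= (1 / (2 ^ (j + 1))%:R)%:E)%E.
  have j0 : 0 < 2 ^+ j :> R by rewrite exprn_gt0.
  have [|r r0 Ir] := small_orlicz_integral oPsi mG mD D0G Dsmall j0 (IG _ j0)
    (c := 1 / (2 ^ (j + 1))%:R); last by exists r.
  by rewrite divr_gt0// ltr0n expn_gt0.
have r0 j : 0 < r j by have [] := rP j.
have [|||Z mZ [Z0 leZ IZ]] := @ae_dominating _ _ _ P _ oPsi (fun j w => 2 ^+ j * D (r j) w).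
- by move=> j; apply: measurable_funM.
- by move=> j w; rewrite mulr_ge0// exprn_ge0.
- by move=> j; have [] := rP j.
(* The constant 1 serves the normalization, [G] the scales [delta >= r j], and [Z] the scales
   [delta < r j]. *)
pose f w := Num.max (Num.max 1 (G w)) (Z w).
have mf : measurable_fun setT f.
  by apply: measurable_maxr => //; apply: measurable_maxr.
have f1 w : 1 <= f w by rewrite !le_max lexx.
have Gf w : G w <= f w by rewrite !le_max lexx orbT.
have Zf w : Z w <= f w by rewrite !le_max lexx !orbT.
have f0 w : 0 < f w by exact: lt_le_trans (f1 w).
have If : (\int[P]_w (Psi (f w))%:E < +oo)%E.
  pose F w := ((Psi 1)%:E + ((Psi (G w))%:E + (Psi (Z w))%:E))%E.
  apply: (@le_lt_trans _ _ (\int[P]_w F w)%E).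
    apply: ge0_le_integral_nonmeasurable => w; rewrite -?EFinD lee_fin ?orlicz_ge0//.
    have := orlicz_ge0 oPsi 1; have := orlicz_ge0 oPsi (G w).
    have := orlicz_ge0 oPsi (Z w); rewrite /f /=.
    by rewrite /Num.max; case: ifP => _; [|case: ifP => _]; lra.
  have Psi0 g w : (0 <= (Psi (g w : R))%:E)%E by rewrite lee_fin orlicz_ge0.
  have mPG : measurable_fun setT (fun w => (Psi (G w))%:E) by exact: measurable_orlicz.
  have mPZ : measurable_fun setT (fun w => (Psi (Z w))%:E) by exact: measurable_orlicz.
  rewrite ge0_integralD//; [|by move=> w _; rewrite lee_fin orlicz_ge0| |].
  - rewrite lte_add_pinfty//.
      by rewrite integral_cst// [X in (_ * X)%E](probability_setT P) mule1 ltry.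
    rewrite ge0_integralD// lte_add_pinfty//.
    by under eq_integral do rewrite -[G _]mul1r; exact: IG.
  - by move=> w _; rewrite adde_ge0.
  - exact: emeasurable_funD.
have [K K0 luxK] := luxemburg_normalize oPsi mf f1 If.
(* The factor [K] cancels the division of [f] by [K], and the summand [|t|] gives strict
   monotonicity. *)
pose h (t : R) := K * (`|t| + affine_inf r `|t|).
have ch : continuous h.
  move=> t; apply: cvgM; first exact: cvg_cst.
  apply: cvgD; first exact: cvg_norm.
  exact: affine_inf_continuous.
have [B [mB PB ZB]] := leZ.
exists (fun w => f w / K), h; split; [split=> //|split|].
- by apply: measurable_funM.
- by move=> w; rewrite divr_ge0// ltW.
- by move=> t _; apply: mulr_ge0 (ltW K0) _; rewrite addr_ge0// affine_inf_ge0.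
- exact: continuous_subspaceT.
- move=> s t; rewrite !in_itv/= => /andP[s0 _] /andP[t0 _] st.
  rewrite ltr_pM2l// !ger0_norm//; apply: ltr_leD => //.
  by apply: affine_inf_mono => //; exact: ltW.
- by rewrite /h normr0 affine_inf0// addr0 mulr0.
exists (N `|` B); split.
- exact: measurableU.
- exact: null_set_setU.
move=> w; apply: contra_notP => NBw delta /andP[delta0 _].
have Nw : ~ N w by move=> Nw; apply: NBw; left.
have leZw j : 2 ^+ j * D (r j) w <= Z w.
  by apply: contrapT => nle; apply: NBw; right; apply: ZB => /(_ j).
have -> : f w / K * h delta = f w * (delta + affine_inf r delta).
  by rewrite /h ger0_norm// mulrA divfK// gt_eqF.
have hpair x y : dist x y <= delta -> `|xi x w - xi y w| <= f w * affine_inf r delta.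
  (* After division by [f w], it is enough to bound the increment by each affine term. If
     [delta < r j], then [D (r j) w <= 2^-j * Z w]; otherwise [delta / r j >= 1] and [G]
     suffices. *)
  move=> xy; rewrite mulrC -ler_pdivrMr//; apply: le_affine_inf => // j.
  rewrite ler_pdivrMr// -(etaNN x)// -(etaNN y)//.
  have j0 : 0 < (1 / 2 : R) ^+ j by rewrite exprn_gt0.
  have [dr|rd] := ltP delta (r j).
    apply: le_trans (hD _ _ _ _ (le_lt_trans xy dr)) _.
    apply: (@le_trans _ _ ((1 / 2) ^+ j * f w)).
      rewrite expr_div_n expr1n mulrC mul1r ler_pdivlMr ?exprn_gt0// mulrC.
      exact: le_trans (leZw j) (Zf w).
    by rewrite ler_pM2r// lerDl divr_ge0// ltW.
  apply: le_trans (hG x y w) _; apply: le_trans (Gf w) _.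
  rewrite ler_peMl ?(ltW (f0 w))//; apply: ler_wpDl; first exact: ltW.
  by rewrite ler_pdivlMr// mul1r.
have rhs0 : 0 <= f w * delta by rewrite mulr_ge0// ltW.
rewrite /modulus mulrDr.
(* If no pair is available, the modulus is the default [sup set0 = 0]. *)
have [[z Ez]|/nonemptyPn E0] := pselect ([set `|xi xy.1 w - xi xy.2 w| | xy in
    [set xy : X * X | dist xy.1 xy.2 <= delta]] !=set0).
  apply: ge_sup; first by exists z.
  by move=> _ [[x y] /= /hpair xy <-]; lra.
by rewrite E0 sup0 addr_ge0// mulr_ge0 ?affine_inf_ge0// ltW.
Qed.
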